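(* Let $\mathcal{F}^n:(\mathbb{R}^{\mathcal{T}})^l\to(\mathbb{R}^{\mathcal{T}})^l$ be a numerical scheme and let $(\mathcal{F}^{\epsilon,\eta})_{\epsilon\ge 0,\eta\ge 0}$ be a regularized scheme of it, in the sense and under the standing assumptions given in the context. Assume that for every $\epsilon>0$ and every $\eta>0$ there exists $p^{\epsilon,\eta}\in(\mathbb{R}^{\mathcal{T}})^l$ with $\mathcal{F}^{\epsilon,\eta}(p^{\epsilon,\eta})=0$. Then there exists $p\in(\mathbb{R}^{\mathcal{T}})^l$ with $\mathcal{F}^n(p)=0$.
   Context: **Model data.** $\Omega\subset\mathbb{R}^d$ ($d\ge1$) is open and bounded, and $l\ge 2$ is an integer. The ''pressures'' are $p=(p_1,\dots,p_l)$ and the ''saturations'' are $u=(u_1,\dots,u_l)$. They satisfy the following. (1) Coupling relation: $u_i=G_i(x,p_1,\dots,p_l)$, where $G=(G_1,\dots,G_l)$ is defined for almost every $x\in\Omega$ and is continuous with respect to $(p_1,\dots,p_l)$. (2) Physical bounds: for each $i$ there are fixed bounds $\underline{u}_i\le\overline{u}_i$ (for example $0$ and $1$ for saturations; for concentrations $\underline u_i=0$ and $\overline u_i=+\infty$). The ''maximum principle'' means $\underline{u}_i\le u_i\le\overline{u}_i$ for $1\le i\le l$. (3) Non-physical quantities: there are a constant $C>0$, functions $g_i(x,s)$ that are Lipschitz continuous in $s$ with constant independent of $x$, and two bijections $\sigma_1,\sigma_2:\{1,\dots,l\}\to\{1,\dots,l\}$ with $\sigma_1(i)\ne\sigma_2(i)$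 for all $i$. The quantities $\zeta_i$ are given, for almost every $x$, by $p_i=\zeta_i+g_i(x,u_i)$, and $|g_i(x,u_i)|\le C|p_{\sigma_1(i)}-p_{\sigma_2(i)}|$ when $u_i=G_i(x,p)$. **Discrete setting.** $\mathcal{T}$ is a space discretization with finitely many degrees of freedom $A\in\mathcal{T}$, each with a point $x_A$ at which the relations above hold. $\mathbb{R}^{\mathcal T}$ is the space of real vectors indexed by $\mathcal{T}$, equipped with a norm $\|\cdot\|_{\mathcal T}$. For $p_{\mathcal T}=(p_{1,\mathcal T},\dots,p_{l,\mathcal T})\in(\mathbb{R}^{\mathcal T})^l$ the discrete quantities are $u_{i,A}=G_i(x_A,p_{1,A},\dots,p_{l,A})$ and $\zeta_{i,A}=p_{i,A}-g_i(x_A,u_{i,A})$. A scheme is a map $p\mapsto \mathcal{F}^n(p)=(\mathcal{F}_{i,A}(p,p^{n-1}))_{1\le i\le l,\,A\in\mathcal T}$, where $p^{n-1}$ is a fixed, already computed solution at the previous time step. A solution is a $p$ with $\mathcal{F}^n(p)=0$. It is assumed that the discrete saturations at time steps $0,\dots,n-1$ satisfy the maximum principle at every $A\in\mathcal T$, and that the scheme has an a priori estimate $\sum_{i=1}^l\|\zeta_{i,\mathcal T}\|_{\mathcal T}^2\le C_\zeta$ for its solutions, with $C_\zeta$ depending only on the mesh, the time step, the previous solution and the physical data. **Regularized scheme.** A regularized scheme of $\mathcal F^n$ is a family of maps $\mathcal{F}^{\epsilon,\eta}:(\mathbb{R}^{\mathcal T})^l\to(\mathbb{R}^{\mathcal T})^l$,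 $\epsilon,\eta\ge0$, such that: (P.a) $\mathcal{F}^{\epsilon,\eta}(p)$ is continuous with respect to $(\epsilon,\eta,p)$. (P.b) $\mathcal{F}^{0,0}=\mathcal{F}^n$. (P.c) For every $\eta\ge 0$, each solution of $\mathcal{F}^{0,\eta}(p)=0$ satisfies the maximum principle $\underline{u}_i\le u_{i,A}\le\overline{u}_i$ for all $i$ and all $A\in\mathcal T$. (P.d) For every $\eta>0$ there is a constant $C_\eta$ independent of $\epsilon>0$ such that every solution of $\mathcal{F}^{\epsilon,\eta}(p)=0$ with $\epsilon>0$ satisfies $$\sum_{i=1}^l\|\zeta_{i,\mathcal T}\|_{\mathcal T}^2+\epsilon\sum_{i=1}^l\|p_{i,\mathcal T}\|_{\mathcal T}^2+\eta\sum_{i=1}^l\|p_{\sigma_1(i),\mathcal T}-p_{\sigma_2(i),\mathcal T}\|_{\mathcal T}^2\le C_\eta .$$ (P.e) There is a constant $C'$ independent of $\eta$ such that for every $\eta>0$ every solution of $\mathcal{F}^{0,\eta}(p)=0$ satisfies $\sum_{i=1}^l\|\zeta_{i,\mathcal T}\|_{\mathcal T}^2\le C'$.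
   Formalization: Added hypothesis: whenever a bound of u_i is infinite, g_i(x_A,·) is assumed bounded on the admissible range of u_i at each A. It is automatic for finite bounds; without it the claim fails, e.g. u_1=max(p_1−p_2,0), g_1(s)=s, u_2=g_2=0, bounds 0,+∞, F^{ε,η}(p)=((ε+η)p_1−1,p_2). *)

(* Defs.v *)
(* MathComp-Analysis *)
From HB Require Import structures.
From mathcomp Require Import all_boot all_order all_algebra all_fingroup.
From mathcomp Require Import all_classical all_reals all_analysis.

Set Implicit Arguments.
Unset Strict Implicit.
Unset Printing Implicit Defensive.

Import Order.TTheory GRing.Theory Num.Theory.
Import numFieldNormedType.Exports.

Local Open Scope classical_set_scope.
Local Open Scope ring_scope.

(* MathComp-Analysis has Lebesgue measure on R only, so null sets of R^d are
   defined by countable covers by boxes of arbitrarily small total volume. *)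
Definition box (R : realType) (d : nat) (a b : 'rV[R]_d) : set 'rV[R]_d :=
  [set x | forall j, a 0 j <= x 0 j <= b 0 j].

Definition lebesgue_null (R : realType) (d : nat) (E : set 'rV[R]_d) : Prop :=
  forall e : R, 0 < e ->
  exists a b : nat -> 'rV[R]_d,
    [/\ forall k j, a k 0 j <= b k 0 j,
        E `<=` \bigcup_k box (a k) (b k)
      & (\sum_(0 <= k <oo) (\prod_j (b k 0 j - a k 0 j))%:E <= e%:E)%E].

Definition ae_in (R : realType) (d : nat) (Om : set 'rV[R]_d)
    (P : 'rV[R]_d -> Prop) : Prop :=
  lebesgue_null (Om `&` [set x | ~ P x]).

(* The relations required of the data at a point x.  G and g are total
   functions; nothing is assumed of their values at other points. *)
Record relations_at (R : realType) (d l : nat)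
    (G : 'rV[R]_d -> 'cV[R]_l -> 'cV[R]_l) (g : 'I_l -> 'rV[R]_d -> R -> R)
    (s1 s2 : {perm 'I_l}) (C : R) (L : 'I_l -> R) (x : 'rV[R]_d) : Prop := {
  coupling_continuous : continuous (G x);
  g_lipschitz : forall i (s t : R), `|g i x s - g i x t| <= L i * `|s - t|;
  g_bound : forall i (p : 'cV[R]_l),
    `|g i x (G x p i 0)| <= C * `|p (s1 i) 0 - p (s2 i) 0| }.

Record model (R : realType) (d l : nat) := Model {
  Omega : set 'rV[R]_d;
  coupling : 'rV[R]_d -> 'cV[R]_l -> 'cV[R]_l;
  ulow : 'I_l -> \bar R;
  uupp : 'I_l -> \bar R;
  gfun : 'I_l -> 'rV[R]_d -> R -> R;
  sigma1 : {perm 'I_l};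
  sigma2 : {perm 'I_l};
  gcst : R;
  glip : 'I_l -> R;
  Omega_open : open Omega;
  Omega_bounded : bounded_set Omega;
  ulow_le_uupp : forall i, (ulow i <= uupp i)%E;
  sigma_neq : forall i, sigma1 i != sigma2 i;
  gcst_gt0 : 0 < gcst;
  relations_ae :
    ae_in Omega (relations_at coupling gfun sigma1 sigma2 gcst glip) }.

Record is_norm (R : realType) (N : nat) (nu : 'rV[R]_N -> R) : Prop := {
  is_norm_eq0 : forall v, nu v = 0 -> v = 0;
  is_normZ : forall (a : R) v, nu (a *: v) = `|a| * nu v;
  is_normD : forall v w, nu (v + w) <= nu v + nu w }.

(* The N degrees of freedom are indexed by 'I_N.  A family
   p = (p_1, ..., p_l) of l vectors of R^N is a matrix p : 'M[R]_(l, N), with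
   row i p the vector p_i and col A p the l values at A. *)
Record discretization (R : realType) (d l : nat) (M : model R d l) (N : nat) :=
  Discretization {
  point : 'I_N -> 'rV[R]_d;
  dnorm : 'rV[R]_N -> R;
  relations_point : forall A,
    relations_at (coupling M) (gfun M) (sigma1 M) (sigma2 M) (gcst M) (glip M)
      (point A);
  dnorm_norm : is_norm dnorm }.

Section Discrete.
Context (R : realType) (d l N : nat) (M : model R d l).
Variable D : discretization M N.
Implicit Type p : 'M[R]_(l, N).

Definition sat p : 'M[R]_(l, N) :=
  \matrix_(i, A) coupling M (point D A) (col A p) i 0.

Definition zeta p : 'M[R]_(l, N) :=
  \matrix_(i, A) (p i A - gfun M i (point D A) (sat p i A)).

Definition maximum_principle p : Prop :=
  forall i A, (ulow M i <= (sat p i A)%:E <= uupp M i)%E.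

Definition sqnorm p : R := \sum_(i < l) dnorm D (row i p) ^+ 2.

Definition sqnorm_diff p : R :=
  \sum_(i < l) dnorm D (row (sigma1 M i) p - row (sigma2 M i) p) ^+ 2.

(* F k p q is the scheme at time step k for the unknown p, q being the solution
   at the previous time step (F may depend on k, e.g. through the length of
   the time step or source terms); hist k is the discrete solution at time step k, and
   hist 0 the initial data. *)
Record scheme_assumptions
    (F : nat -> 'M[R]_(l, N) -> 'M[R]_(l, N) -> 'M[R]_(l, N))
    (n : nat) (hist : nat -> 'M[R]_(l, N)) : Prop := {
  hist_solution : forall k, (0 < k < n)%N -> F k (hist k) (hist k.-1) = 0;
  hist_maximum : forall k, (k < n)%N -> maximum_principle (hist k);
  apriori : exists Cz : R, forall p, F n p (hist n.-1) = 0 ->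
    sqnorm (zeta p) <= Cz }.

(* Freg eps eta is meaningful only for eps, eta >= 0. *)
Record regularized_scheme (Fn : 'M[R]_(l, N) -> 'M[R]_(l, N))
    (Freg : R -> R -> 'M[R]_(l, N) -> 'M[R]_(l, N)) : Prop := {
  reg_continuous :
    {within [set z : R * R * 'M[R]_(l, N) | 0 <= z.1.1 /\ 0 <= z.1.2],
      continuous (fun z => Freg z.1.1 z.1.2 z.2)};
  reg_00 : forall p, Freg 0 0 p = Fn p;
  reg_maximum : forall eta : R, 0 <= eta ->
    forall p, Freg 0 eta p = 0 -> maximum_principle p;
  reg_estimate : forall eta : R, 0 < eta ->
    exists Ceta : R, forall eps : R, 0 < eps ->
    forall p, Freg eps eta p = 0 ->
      sqnorm (zeta p) + eps * sqnorm p + eta * sqnorm_diff p <= Ceta;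
  reg_zeta : exists C' : R, forall eta : R, 0 < eta ->
    forall p, Freg 0 eta p = 0 -> sqnorm (zeta p) <= C' }.

(* Void when all the bounds are finite.  With ulow i or uupp i infinite, the
   maximum principle and the estimates on zeta do not bound p, and existence
   can fail: take N = 1, l = 2, sigma1 = id, G_1(p) = max(p_1 - p_2, 0),
   g_1(s) = s, G_2 = g_2 = 0, bounds 0 and +oo, and
   Freg eps eta p = ((eps + eta) p_1 - 1, p_2). *)
Definition g_bounded_if_infinite : Prop :=
  forall i, ~~ ((ulow M i \is a fin_num) && (uupp M i \is a fin_num)) ->
  forall A, exists K : R, forall s : R,
    (ulow M i <= s%:E <= uupp M i)%E -> `|gfun M i (point D A) s| <= K.

End Discrete.

(* Main.v *)
(* The regularization parameters are sent to 0 one after the other.  In both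
   limits p = zeta + g is bounded: at fixed eta > 0 the estimate controls the
   pressure differences, hence g, uniformly in eps; at eps = 0 the maximum
   principle controls g uniformly in eta.  Zeros of a continuous family that
   stay in a compact set have a zero of the limit map as a cluster point. *)
Require Import Defs.
From mathcomp Require Import lra.
From HB Require Import structures.
From mathcomp Require Import all_boot all_order all_algebra all_fingroup.
From mathcomp Require Import all_classical all_reals all_analysis.
Import Order.TTheory GRing.Theory Num.Theory.
Import numFieldNormedType.Exports.
Local Open Scope classical_set_scope.
Local Open Scope ring_scope.

(** * Compactness and zeros of limit maps *)

Lemma normr_entry_le {R : realType} {m n} (v : 'M[R]_(m, n)) i j :
  `|v i j| <= `|v|.
Proof.
rewrite [leRHS]/Num.norm /= mx_normrE; apply/bigmax_geP; right => /=.
by exists (i, j).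
Qed.

(** The box is the image under [vec_mx] of a finite product of segments, which is compact. *)
Lemma compact_mx_box {R : realType} {m n} (K : R) :
  compact [set p : 'M[R]_(m, n) | forall i j, `|p i j| <= K].
Proof.
(* Balls are entrywise on both sides and [vec_mx] only reindexes the entries, so the same radius
   works. *)
have cvec : continuous (vec_mx : 'rV[R]_(m * n) -> 'M[R]_(m, n)).
  move=> v; apply/(@cvg_ballP _ _ _ (nbhs v) _ vec_mx) => e e0.
  apply: filterS (nbhsx_ballx v e e0) => w [_ vw].
  by split=> // i j; rewrite !mxE; exact: vw.
have -> : [set p : 'M[R]_(m, n) | forall i j, `|p i j| <= K] =
    vec_mx @` [set v : 'rV[R]_(m * n) | forall k, `[- K, K]%classic (v 0 k)].
  apply/seteqP; split=> [p hp|_ [v hv <-] i j].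
    exists (mxvec p); last exact: mxvecK.
    move=> k; case/mxvec_indexP: k => i j.
    by rewrite mxvecE /= in_itv /= -ler_norml.
  by rewrite mxE ler_norml; have := hv (mxvec_index i j); rewrite /= in_itv.
apply: continuous_compact; first exact: continuous_subspaceT.
apply: (@rV_compact _ _ (fun=> `[- K, K]%classic)) => _.
exact: segment_compact.
Qed.

(** If [f 0] vanished nowhere, each point of [K] would have a neighbourhood on which [f e] has no
    zero for small [e > 0]. Compactness, in its near-covering form, makes this smallness uniform
    over [K], against the zeros given in [K]. The limit is taken within [0 <= e] because the scheme
    is controlled only for nonnegative parameters. *)
Lemma zero_at_limit {R : realType} {V : topologicalType} {W : normedModType R}
    (K : set V) (f : R -> V -> W) :
  compact K ->
  (forall p, K p ->
    f z.1 z.2 @[z --> within [set z : R * V | 0 <= z.1] (nbhs (0, p))]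
      --> f 0 p) ->
  (forall e, 0 < e -> exists2 p, K p & f e p = 0) ->
  exists p, f 0 p = 0.
Proof.
move=> /compact_near_coveringP cK cf fz; apply: contrapT => nz.
have H : \forall e \near (0 : R)^'+, K `<=` (fun p => f e p != 0).
  apply: (cK _ (0 : R)^'+ (fun e p => f e p != 0)) => p Kp.
  have f0 : f 0 p != 0 by apply/eqP => f0; apply: nz; exists p.
  have := cvgr_neq0 _ (cf p Kp) f0.
  rewrite /= => -[[A B]] /= [A0 Bp] AB.
  (* [AB] gives nonvanishing only for nonnegative parameters, hence the restriction of [A] to
     positive [e]. *)
  exists (B, [set e | A e /\ 0 < e]) => /=.
    split=> //; apply: filterI; first exact: cvg_at_right_filter A0.
    exact: nbhs_right_gt.
  by move=> [q e] /= [Bq [Ae e0]]; apply: (AB (e, q)) => //; exact: ltW.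
have [e [He e0]] : exists e : R, K `<=` (fun p => f e p != 0) /\ 0 < e.
  apply: (@filter_ex _ (0 : R)^'+).
  by apply: filterI => //; exact: nbhs_right_gt.
by have [p Kp /eqP] := fz e e0; apply/negP/He.
Qed.

(** * Comparison of an arbitrary norm on row vectors with the sup norm *)

Section Norm.
Context {R : realType} {N : nat} (nu : 'rV[R]_N -> R) (hnu : is_norm nu).

Lemma is_norm0 : nu 0 = 0.
Proof. by rewrite -(scale0r 0) (is_normZ hnu) normr0 mul0r. Qed.

Lemma is_normN v : nu (- v) = nu v.
Proof. by rewrite -scaleN1r (is_normZ hnu) normrN1 mul1r. Qed.

Lemma is_norm_ge0 v : 0 <= nu v.
Proof.
have := is_normD hnu v (- v).
by rewrite subrr is_norm0 is_normN -mulr2n pmulrn_lge0.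
Qed.

Lemma is_norm_sum (I : Type) (r : seq I) (F : I -> 'rV[R]_N) :
  nu (\sum_(i <- r) F i) <= \sum_(i <- r) nu (F i).
Proof.
elim/big_ind2 : _ => [|v x w y hv hw|//]; first by rewrite is_norm0.
by rewrite (le_trans (is_normD hnu _ _))// lerD.
Qed.

Lemma is_norm_le_normr : exists C : R, forall v, nu v <= C * `|v|.
Proof.
exists (\sum_j nu (delta_mx 0 j)) => v.
rewrite [in nu v](row_sum_delta v) (le_trans (is_norm_sum _ _ _))// mulr_suml.
apply: ler_sum => j _; rewrite (is_normZ hnu) mulrC.
by rewrite ler_wpM2l ?is_norm_ge0 ?normr_entry_le.
Qed.

Lemma is_norm_continuous : continuous nu.
Proof.
have [C hC] := is_norm_le_normr.
move=> v; apply/(@cvgrPdist_le _ _ _ (nbhs v) _ nu) => e e0; near=> w.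
have hw : nu (v - w) <= e.
  apply: (le_trans (hC _)).
  (* The sign of [C] is unknown; [|C| + 1] is positive, so [e] can be divided by it. *)
  apply: (@le_trans _ _ ((`|C| + 1) * `|v - w|)).
    by rewrite ler_wpM2r// (le_trans (ler_norm _))// lerDl.
  have C1 : 0 < `|C| + 1 by rewrite ltr_wpDl.
  rewrite mulrC -ler_pdivlMr//; near: w.
  by apply: cvgr_dist_le; [exact: cvg_id|exact: divr_gt0].
have tri x y : nu x <= nu (x - y) + nu y.
  by rewrite (le_trans _ (is_normD hnu _ _))// subrK.
have := tri v w; have := tri w v; rewrite -(is_normN (w - v)) opprB => vw wv.
by rewrite ler_norml; apply/andP; split; lra.
Unshelve. all: by end_near. Qed.

(** By continuity [nu] attains a minimum on the compact unit sphere of the sup norm, and it is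
    positive there; [c] is its inverse, and homogeneity extends the bound to all vectors. *)
Lemma normr_le_is_norm : exists2 c : R, 0 < c & forall v, `|v| <= c * nu v.
Proof.
pose S := [set v : 'rV[R]_N | `|v| = 1].
have cS : compact S.
  apply: bounded_closed_compact.
    exists 1; split; first exact: num_real.
    by move=> x x1 v; rewrite /S /= => ->; exact: ltW.
  apply: (@preimage_closed _ _ (fun v : 'rV[R]_N => `|v|) [set 1]) => // v _.
  exact: norm_continuous.
(* The sphere is empty when [N = 0], where the only vector is zero and there is no minimum to
   take. *)
have [S0|/set0P S0] := eqVneq S set0.
  exists 1 => // v; have [->|v0] := eqVneq v 0.
    by rewrite normr0 mul1r is_norm_ge0.
  have : S (`|v|^-1 *: v).
    by rewrite /S /= normrZ normfV normr_id mulVf// normr_eq0.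
  by rewrite S0.
have [v0 Sv0 hv0] := EVT_min_rV S0 cS (continuous_subspaceT is_norm_continuous).
move: Sv0; rewrite inE => Sv0.
have nv0 : 0 < nu v0.
  rewrite lt_neqAle is_norm_ge0 andbT eq_sym; apply/eqP.
  move/(is_norm_eq0 hnu) => v00.
  by move: Sv0; rewrite /S /= v00 normr0 => /esym/eqP; rewrite oner_eq0.
exists (nu v0)^-1; first by rewrite invr_gt0.
move=> v; have [->|v1] := eqVneq v 0.
  by rewrite normr0 mulr_ge0 ?is_norm_ge0 ?invr_ge0 ?is_norm_ge0.
have nv : 0 < `|v| by rewrite normr_gt0.
have : S (`|v|^-1 *: v).
  by rewrite /S /= normrZ normfV normr_id mulVf// normr_eq0.
move=> /mem_set /hv0; rewrite (is_normZ hnu) normfV normr_id.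
by rewrite mulrC ler_pdivlMr// ler_pdivlMl.
Qed.

(** The inequality [x <= 1 + x ^ 2] turns a bound on squares into a bound on entries without square
    roots. The constant [c] depends on the norm alone, so uniformity in the parameters is inherited
    from [C]. *)
Lemma entry_le_sum_sqr : exists2 c : R, 0 < c &
  forall l (v : 'I_l -> 'rV[R]_N) (C : R), \sum_(i < l) nu (v i) ^+ 2 <= C ->
  forall i A, `|v i 0 A| <= c * (1 + C).
Proof.
have [c c0 hc] := normr_le_is_norm; exists c => // l v C hC i A.
rewrite (le_trans (normr_entry_le _ _ _))// (le_trans (hc _))// ler_pM2l//.
have : nu (v i) ^+ 2 <= C.
  rewrite (le_trans _ hC)// (bigD1 i)//= lerDl.
  by apply: sumr_ge0 => j _; exact: sqr_ge0.
have := sqr_ge0 (nu (v i) - 1); have := sqr_ge0 (nu (v i)).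
rewrite sqrrB1; nra.
Qed.

End Norm.

(** Serves to restrict the joint continuity of [Freg] on the quadrant to a half-line of parameters,
    one of them being frozen. *)
Lemma cvg_within_comp {T U V : topologicalType} (g : T -> U) (f : U -> V)
    (A : set T) (B : set U) (x : T) :
  {for x, continuous g} -> (forall y, A y -> B (g y)) ->
  f y @[y --> within B (nbhs (g x))] --> f (g x) ->
  f (g y) @[y --> within A (nbhs x)] --> f (g x).
Proof.
move=> cg AB cf W fW; have gW := cg _ (cf W fW).
apply: (@filterS _ (nbhs x) _ _ _ _ gW) => y Wy Ay; exact: Wy (AB y Ay).
Qed.

(** * Bounds on the pressures and the two successive limits *)

Section Limit.
Context {R : realType} {d l N : nat} {M : model R d l} (D : discretization M N).
Implicit Type p : 'M[R]_(l, N).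

Lemma entry_le_zeta_g p i A :
  `|p i A| <= `|zeta D p i A| + `|gfun M i (Defs.point D A) (sat D p i A)|.
Proof. by rewrite (le_trans _ (ler_normD _ _))// [zeta D p i A]mxE subrK. Qed.

Lemma g_le_pressure_diff p i A : `|gfun M i (Defs.point D A) (sat D p i A)| <=
  gcst M * `|p (sigma1 M i) A - p (sigma2 M i) A|.
Proof.
have := g_bound (relations_point D A) i (col A p).
by rewrite [sat D p i A]mxE [col A p (_ _) 0]mxE [col A p (sigma2 M i) 0]mxE.
Qed.

(** When both bounds are finite, the saturation ranges over a bounded interval and the Lipschitz
    estimate from the base point 0 bounds g; otherwise the hypothesis supplies the bound. *)
Lemma g_bounded_of_maximum : g_bounded_if_infinite D ->
  exists K : R, forall p, maximum_principle D p ->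
  forall i A, `|gfun M i (Defs.point D A) (sat D p i A)| <= K.
Proof.
move=> hg.
have /choice[K hK] : forall k : 'I_l * 'I_N, exists K : R, forall s : R,
    (ulow M k.1 <= s%:E <= uupp M k.1)%E -> `|gfun M k.1 (Defs.point D k.2) s|
    <= K.
  move=> [i A] /=.
  have [/andP[/fineK <- /fineK <-]|/hg] :=
    boolP ((ulow M i \is a fin_num) && (uupp M i \is a fin_num)); last exact.
  set a := fine _; set b := fine _.
  exists (`|gfun M i (Defs.point D A) 0| + `|glip M i| * (`|a| + `|b|)) => s.
  rewrite !lee_fin => /andP[sa sb].
  have hs : `|s| <= `|a| + `|b|.
    have := ler_norm b; have := ler_norm (- a); rewrite normrN => ha hb.
    have := normr_ge0 a; have := normr_ge0 b => ? ?.
    by rewrite ler_norml; apply/andP; split; lra.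
  rewrite -[X in `|X|](subrK (gfun M i (Defs.point D A) 0)) addrC.
  rewrite (le_trans (ler_normD _ _))// lerD2l.
  rewrite (le_trans (g_lipschitz (relations_point D A) i s 0))// subr0.
  by rewrite (le_trans (ler_wpM2r _ (ler_norm _)))// ler_wpM2l.
(* There are finitely many pairs [(i, A)], so this sum dominates every [K k]. *)
exists (\sum_k `|K k|) => p hp i A.
rewrite (le_trans (hK (i, A) _ (hp i A)))// (le_trans (ler_norm _))//.
by rewrite (bigD1 (i, A))//= lerDl sumr_ge0.
Qed.

Context {Fn : 'M[R]_(l, N) -> 'M[R]_(l, N)}
  {Freg : R -> R -> 'M[R]_(l, N) -> 'M[R]_(l, N)}
  (hreg : regularized_scheme D Fn Freg).

Lemma zero_eps0 (eta : R) : 0 < eta ->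
  (forall eps, 0 < eps -> exists p, Freg eps eta p = 0) ->
  exists p, Freg 0 eta p = 0.
Proof.
move=> eta0 hex.
have [c c0 hc] := entry_le_sum_sqr _ (dnorm_norm D).
have [Ceta hCeta] := reg_estimate hreg eta0.
(* The first term bounds [zeta]. The second bounds g through the pressure differences, since
   [eta * sqnorm_diff D p <= Ceta]. Neither involves [eps]. *)
pose K := c * (1 + Ceta) + gcst M * (c * (1 + Ceta / eta)).
apply: (zero_at_limit _ (fun eps => Freg eps eta) (compact_mx_box K)) =>
    [p _|eps eps0].
  have /subspace_continuousP/(_ ((0, eta), p)) cF := reg_continuous hreg.
  apply: (@cvg_within_comp _ _ _
    (fun z : R * 'M[R]_(l, N) => ((z.1, eta), z.2))
    (fun z => Freg z.1.1 z.1.2 z.2) [set z | 0 <= z.1]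
    [set z | 0 <= z.1.1 /\ 0 <= z.1.2] (0, p)).
  - apply: (@cvg_pair _ _ _ (nbhs ((0 : R), p)) (nbhs ((0 : R), eta)) (nbhs p)
      _ _ _ (fun z => (z.1, eta)) snd); last exact: cvg_snd.
    apply: (@cvg_pair _ _ _ (nbhs ((0 : R), p)) (nbhs (0 : R)) (nbhs eta)
      _ _ _ fst (fun=> eta)); [exact: cvg_fst|exact: cvg_cst].
  - by move=> z /= z0; split=> //; exact: ltW.
  - by apply: cF; split=> //; exact: ltW.
have [p Fp0] := hex _ eps0; exists p => // i A.
have sqnorm_ge0 (q : 'M[R]_(l, N)) : 0 <= sqnorm D q.
  by apply: sumr_ge0 => j _; exact: sqr_ge0.
have diff_ge0 : 0 <= sqnorm_diff D p.
  by apply: sumr_ge0 => j _; exact: sqr_ge0.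
have est := hCeta eps eps0 p Fp0.
have eps_ge0 := mulr_ge0 (ltW eps0) (sqnorm_ge0 p).
have eta_ge0 := mulr_ge0 (ltW eta0) diff_ge0.
have zeta_ge0 := sqnorm_ge0 (zeta D p).
rewrite (le_trans (entry_le_zeta_g _ _ _))// lerD//.
  have := hc l (fun i => row i (zeta D p)) Ceta.
  by move=> /(_ _ i A); rewrite mxE; apply; rewrite -/(sqnorm _ _); lra.
rewrite (le_trans (g_le_pressure_diff _ _ _))// ler_pM2l ?gcst_gt0//.
have := hc l (fun i => row (sigma1 M i) p - row (sigma2 M i) p) (Ceta / eta).
move=> /(_ _ i A); rewrite !mxE; apply; rewrite -/(sqnorm_diff _ _).
by rewrite ler_pdivlMr// mulrC; lra.
Qed.

(** The previous bound on g contains [Ceta / eta] and gives no uniform control as [eta] tends to 0.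
    The maximum principle, available now that [eps = 0], replaces it. *)
Lemma zero_eps0_eta0 : g_bounded_if_infinite D ->
  (forall eta, 0 < eta -> exists p, Freg 0 eta p = 0) ->
  exists p, Freg 0 0 p = 0.
Proof.
move=> hg hex.
have [c c0 hc] := entry_le_sum_sqr _ (dnorm_norm D).
have [C' hC'] := reg_zeta hreg.
have [K hK] := g_bounded_of_maximum hg.
pose B := c * (1 + C') + K.
apply: (zero_at_limit _ (fun eta => Freg 0 eta) (compact_mx_box B)) =>
    [p _|eta eta0].
  have /subspace_continuousP/(_ ((0, 0), p)) cF := reg_continuous hreg.
  apply: (@cvg_within_comp _ _ _
    (fun z : R * 'M[R]_(l, N) => ((0, z.1), z.2))
    (fun z => Freg z.1.1 z.1.2 z.2) [set z | 0 <= z.1]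
    [set z | 0 <= z.1.1 /\ 0 <= z.1.2] (0, p)) => //.
  - apply: (@cvg_pair _ _ _ (nbhs ((0 : R), p)) (nbhs ((0 : R), (0 : R))) (nbhs p)
      _ _ _ (fun z => (0, z.1)) snd); last exact: cvg_snd.
    apply: (@cvg_pair _ _ _ (nbhs ((0 : R), p)) (nbhs (0 : R)) (nbhs (0 : R))
      _ _ _ (fun=> 0) fst); [exact: cvg_cst|exact: cvg_fst].
  - exact: cF.
have [p Fp0] := hex _ eta0; exists p => // i A.
rewrite (le_trans (entry_le_zeta_g _ _ _))// lerD//.
  have := hc l (fun i => row i (zeta D p)) C' (hC' eta eta0 p Fp0) i A.
  by rewrite mxE.
by apply: hK; apply: (reg_maximum hreg) Fp0; exact: ltW.
Qed.

End Limit.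

Theorem theorem4 (R : realType) (d l N : nat) (hd : (1 <= d)%N) (hl : (2 <= l)%N)
  (M : model R d l) (D : discretization M N)
  (F : nat -> 'M[R]_(l, N) -> 'M[R]_(l, N) -> 'M[R]_(l, N))
  (n : nat) (hn : (1 <= n)%N) (hist : nat -> 'M[R]_(l, N))
  (hF : scheme_assumptions D F n hist)
  (Freg : R -> R -> 'M[R]_(l, N) -> 'M[R]_(l, N))
  (hreg : regularized_scheme D (fun p => F n p (hist n.-1)) Freg)
  (hg : g_bounded_if_infinite D)
  (hex : forall eps eta : R, 0 < eps -> 0 < eta ->
    exists p : 'M[R]_(l, N), Freg eps eta p = 0) :
  exists p : 'M[R]_(l, N), F n p (hist n.-1) = 0.
Proof.
have [p Fp] : exists p, Freg 0 0 p = 0.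
  apply: (zero_eps0_eta0 D hreg hg) => eta eta0.
  by apply: (zero_eps0 D hreg _ eta0) => eps eps0; exact: hex.
by exists p; rewrite -(reg_00 hreg).
Qed.
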